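(* Let $X\sim F$ be a nonnegative, continuous, strictly DGMRD demand distribution with finite mean $\mu$ and finite variance $\sigma^2$, and let $X_\kappa:=\kappa X+(1-\kappa)\mu$ for $\kappa\in[0,1]$. Then $X_\kappa\preceq_{\mathrm{mrd}}X$ and $r^*_\kappa\le r^*$, where $r^*_\kappa$ and $r^*$ denote the supplier's optimal wholesale prices in markets $X_\kappa$ and $X$, respectively.
   Context: For a nonnegative random variable $X$ with cdf $F$, finite mean, $\bar F:=1-F$ and $H=\inf\{r\ge0:F(r)=1\}\in(0,\infty]$, the mean residual demand (MRD) function is $\mathrm{m}_X(r):=\mathbb{E}(X-r\mid X>r)=\frac{1}{\bar F(r)}\int_r^\infty\bar F(u)\,du$ for $r<H$ and $\mathrm{m}_X(r):=0$ otherwise. ''Continuous'' means the cdf is non-atomic with $F(0)=0$; the degenerate (deterministic) case $X_0\equiv\mu$ is allowed for the transformed variable. $X$ is (strictly) DGMRD if $\ell(r):=\mathrm{m}_X(r)/r$ is (strictly) decreasing on $(0,H)$. $X_1\preceq_{\mathrm{mrd}}X_2$ means $\mathrm{m}_{X_1}(r)\le\mathrm{m}_{X_2}(r)$ for all $r\ge0$. The supplier's optimal wholesale price in market $X$ is the maximizer of $r\,\mathbb{E}(X-r)_+$ over $r\ge0$, where $(x)_+=\max\{0,x\}$; for strictly DGMRD $X$ with finite second moment it exists and is the unique solution of $r=\mathrm{m}_X(r)$ (for deterministic demand $\mu$ it is $\mu/2$). *)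

(* Defs.v *)
From HB Require Import structures.
From mathcomp Require Import all_boot all_order all_algebra.
From mathcomp Require Import all_classical all_reals all_analysis.

Set Implicit Arguments.
Unset Strict Implicit.
Unset Printing Implicit Defensive.

Import Order.TTheory GRing.Theory Num.Theory.

Local Open Scope classical_set_scope.
Local Open Scope ring_scope.

Section MeanResidualDemand.
Context (d : measure_display) (T : measurableType d) (R : realType)
  (P : probability T R).

(* E(Y | A) for an event A; meaningful when P A > 0 and Y is integrable. *)
Definition cond_expect (Y : T -> R) (A : set T) : R :=
  fine (\int[P]_(t in A) (Y t)%:E)%E / fine (P A).

(* The set is empty, and the value is then +oo, when F stays below 1. *)
Definition support_end (X : {RV P >-> R}) : \bar R :=
  ereal_inf [set r%:E | r in [set r : R | 0 <= r /\ cdf X r = 1%E]].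

Definition mrd (X : {RV P >-> R}) (r : R) : R :=
  if (r%:E < support_end X)%E
  then cond_expect (fun t => X t - r) [set t | r < X t]
  else 0.

Definition non_atomic (X : {RV P >-> R}) : Prop :=
  forall x : R, distribution P X [set x] = 0%E.

Definition continuous_demand (X : {RV P >-> R}) : Prop :=
  non_atomic X /\ cdf X 0 = 0%E.

Definition strictly_DGMRD (X : {RV P >-> R}) : Prop :=
  forall r s : R, 0 < r -> r < s -> (s%:E < support_end X)%E ->
    mrd X s / s < mrd X r / r.

Definition supplier_payoff (X : {RV P >-> R}) (r : R) : \bar R :=
  (r%:E * 'E_P[fun t => Num.max 0%R (X t - r)%R])%E.

(* A relation rather than a function: outside the DGMRD class the payoff can
   have several maximizers, and strict DGMRD of X does not pass to X_kappa. *)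
Definition optimal_price (X : {RV P >-> R}) (r : R) : Prop :=
  0 <= r /\
  forall s : R, 0 <= s -> (supplier_payoff X s <= supplier_payoff X r)%E.

Definition mix_with_const (kappa mu : R) (X : {RV P >-> R}) : {RV P >-> R} :=
  kappa *: (X : {mfun T >-> R}) + cst ((1 - kappa) * mu).

End MeanResidualDemand.

Definition mrd_le (R : realType)
    (d1 : measure_display) (T1 : measurableType d1) (P1 : probability T1 R)
    (d2 : measure_display) (T2 : measurableType d2) (P2 : probability T2 R)
    (X1 : {RV P1 >-> R}) (X2 : {RV P2 >-> R}) : Prop :=
  forall r : R, 0 <= r -> mrd X1 r <= mrd X2 r.

(* Main.v *)
(* Write G(r) = E(X - r)_+ and S(r) = P(X > r), so that m_X = G / S.  For
   kappa > 0 and r = kappa q + (1 - kappa) mu one has m_{X_kappa}(r) =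
   kappa m_X(q).  If r >= mu then q >= r, and monotonicity of m_X(r) / r gives
   kappa m_X(q) <= (kappa q / r) m_X(r) <= m_X(r).  If r < mu then q <= r; since
   E(X | X > r) = m_X(r) + r is nondecreasing and at least mu,
   m_X(r) >= m_X(q) - (1 - kappa) (mu - q) >= kappa m_X(q).
   For the prices, (t - s) S(t) <= G(s) - G(t) <= (t - s) S(s) for s <= t.
   Comparing a maximizer s of r G(r) with (s + m(s)) / 2 then gives m(s) = s
   without differentiating G, hence also for the deterministic X_0.  If
   r_kappa > r_star, then m_X(r_kappa) >= m_{X_kappa}(r_kappa) >= r_kappa while
   m_X(r_star) <= r_star, contradicting the strict decrease of m_X(r) / r. *)
Require Import Defs.
From mathcomp Require Import all_boot all_order all_algebra.
From mathcomp Require Import all_classical all_reals all_analysis.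
From mathcomp Require Import measurable_realfun ring lra.
Import Order.TTheory GRing.Theory Num.Theory.
Local Open Scope classical_set_scope.
Local Open Scope ring_scope.

(** * Survival function and expected excess over a threshold *)

Section Excess.
Context {d : measure_display} {T : measurableType d} {R : realType}
  {P : probability T R}.
Implicit Types (Y : {RV P >-> R}) (q r s : R).

(** The stop-loss transform [G], taken as a real number so that linear arithmetic applies;
    [supplier_payoffE] ties it to the extended-real expectation for integrable [Y]. *)
Definition excess Y r : R := \int[P]_t Num.max 0 (Y t - r).

Definition survival Y r : R := fine (P [set t | r < Y t]).

Lemma measurable_gt_RV Y r : measurable [set t | r < Y t].
Proof.
have -> : [set t | r < Y t] = Y @^-1` `]r, +oo[%classic.
  by apply/seteqP; split => t /=; rewrite in_itv/= andbT.
exact: measurable_funPTI.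
Qed.
Local Hint Resolve measurable_gt_RV : core.

Lemma survivalK Y r : (survival Y r)%:E = P [set t | r < Y t].
Proof. by rewrite /survival fineK// fin_num_measure. Qed.

Lemma survival_ge0 Y r : 0 <= survival Y r.
Proof. exact: fine_ge0. Qed.

Lemma survival_le1 Y r : survival Y r <= 1.
Proof. by rewrite -lee_fin survivalK probability_le1. Qed.

Lemma indic_gt Y r t : \1_[set t | r < Y t] t = (r < Y t)%R%:R :> R.
Proof.
by rewrite indicE; congr (nat_of_bool _)%:R; apply/idP/idP; rewrite inE.
Qed.

Lemma cdf_survival Y r : cdf Y r = (1 - survival Y r)%:E.
Proof.
rewrite EFinB survivalK -probability_setC//.
rewrite /cdf /distribution /pushforward; congr (P _).
by apply/seteqP; split => t /=; rewrite in_itv/= leNgt => /negP.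
Qed.

Lemma survival_nonincreasing Y r s : r <= s -> survival Y s <= survival Y r.
Proof.
move=> rs; rewrite -lee_fin !survivalK; apply: le_measure; rewrite ?inE//.
by move=> t /= /(le_lt_trans rs).
Qed.

(** If the survival at [r] vanishes, [r] itself lies in the set whose infimum is taken. If it is
    positive, right-continuity of the cdf keeps it positive at some [s > r], and [s] is then a lower
    bound of that set; this is what makes the inequality strict. *)
Lemma lt_support_end Y r : 0 <= r ->
  (r%:E < support_end Y)%E = (0 < survival Y r).
Proof.
move=> r0; apply/idP/idP => [rH|S0].
  rewrite lt_neqAle survival_ge0 andbT; apply/negP => /eqP S0.
  move: rH; rewrite ltNge => /negP; apply.
  by apply: ereal_inf_lbound; exists r => //=; rewrite cdf_survival -S0 subr0.
have [s rs Ss] : exists2 s, r < s & 0 < survival Y s.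
  have : \forall s \near r^'+, (cdf Y s < 1)%E.
    have nb : nbhs (cdf Y r) [set x | (x < 1)%E].
      apply: open_nbhs_nbhs; split; first exact: open_ereal_lt_ereal.
      by rewrite /= cdf_survival lte_fin ltrBlDr ltrDl.
    exact: (@cdf_right_continuous _ _ _ _ Y r _ nb).
  move=> cdf1.
  have : \forall s \near r^'+, r < s /\ (cdf Y s < 1)%E.
    by near=> s; split; near: s => //; exact: nbhs_right_gt.
  move=> /filter_ex [s [rs]].
  by rewrite cdf_survival lte_fin ltrBlDr ltrDl; exists s.
rewrite (@lt_le_trans _ _ s%:E) ?lte_fin//.
apply: le_ereal_inf_tmp => _ [x [x0 Fx] <-].
rewrite lee_fin leNgt; apply/negP => xs.
have := survival_nonincreasing Y x s (ltW xs).
move: Fx; rewrite cdf_survival => -[]; lra.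
Unshelve. all: by end_near. Qed.

Lemma Rintegral_cst_probability (c : R) : \int[P]_t c = c.
Proof.
by rewrite Rintegral_cst// [X in fine X](probability_setT P) mulr1.
Qed.

Lemma excess_cond Y r : excess Y r = \int[P]_(t in [set t | r < Y t]) (Y t - r).
Proof.
rewrite Rintegral_mkcond; apply: eq_Rintegral => t _.
rewrite patchE; case: ifPn; rewrite ?inE ?notin_setE /= => h.
  by rewrite max_r// subr_ge0 ltW.
by rewrite max_l// subr_le0 leNgt; apply/negP.
Qed.

Lemma excess_ge0 Y r : 0 <= excess Y r.
Proof. by apply: Rintegral_ge0 => t _; rewrite le_max lexx. Qed.

Lemma excess0 Y r : survival Y r = 0 -> excess Y r = 0.
Proof.
move=> S0; rewrite excess_cond /Rintegral null_set_integral//.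
  apply/measurable_EFinP; apply: measurable_funB => //.
  exact: measurable_funTS.
exact: (etrans (esym (survivalK Y r)) (congr1 EFin S0)).
Qed.

(** From the end of the support on, the survival is 0 and division by 0 gives 0, the default value
    in [mrd]; one formula thus covers both branches. *)
Lemma mrdE Y r : 0 <= r -> mrd Y r = excess Y r / survival Y r.
Proof.
move=> r0; rewrite /mrd lt_support_end//; case: ifPn => [_|].
  by rewrite excess_cond.
rewrite lt_neqAle survival_ge0 andbT negbK => /eqP <-.
by rewrite invr0 mulr0.
Qed.

Lemma mrd_ge0 Y r : 0 <= r -> 0 <= mrd Y r.
Proof. by move=> r0; rewrite mrdE// divr_ge0 ?excess_ge0 ?survival_ge0. Qed.

(** * Slope bounds and conditional means for integrable demand *)

Section Integrable.
Variable Y : {RV P >-> R}.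
Hypothesis iY : P.-integrable setT (EFin \o Y).

Lemma integrable_excess r :
  P.-integrable setT (EFin \o (fun t => Num.max 0 (Y t - r))).
Proof.
have iYr : P.-integrable setT (fun t => (Y t - r)%:E).
  rewrite (_ : (fun t => _) = ((EFin \o Y) \- (EFin \o cst r))%E)//.
  by apply: integrableB => //; exact: finite_measure_integrable_cst.
apply: (le_integrable measurableT _ _ iYr).
  apply/measurable_EFinP; apply: measurable_maxr => //.
  by apply: measurable_funB.
move=> t _; rewrite lee_fin/= ger0_norm ?le_max ?lexx//.
by rewrite ge_max normr_ge0 ler_norm.
Qed.

Lemma Rintegral_excessD_survival q r (c : R) :
  \int[P]_t (Num.max 0 (Y t - q) + c * \1_[set t | r < Y t] t) =
  excess Y q + c * survival Y r.
Proof.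
have iI : P.-integrable setT (fun t => (\1_[set t | r < Y t] t)%:E).
  exact: integrable_indic.
rewrite RintegralD//; first 1 last.
- exact: integrable_excess.
- rewrite (_ : EFin \o _ = fun t => (c%:E * (\1_[set t | r < Y t] t)%:E)%E)//.
  exact: integrableZl.
by rewrite RintegralZl// {2}/Rintegral integral_indic// setIT.
Qed.

Lemma integrable_excessD_survival q r (c : R) : P.-integrable setT
  (EFin \o (fun t => Num.max 0 (Y t - q) + c * \1_[set t | r < Y t] t)).
Proof.
rewrite (_ : EFin \o _ = ((EFin \o (fun t => Num.max 0%R (Y t - q)%R)) \+
  (fun t => c%:E * (\1_[set t | r < Y t] t)%:E))%E)//.
apply: integrableD => //; first exact: integrable_excess.
by apply: integrableZl => //; exact: integrable_indic.
Qed.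

(** Integrates the pointwise bound [(Y - q)_+ <= (Y - r)_+ + (r - q) 1_{Y > q}]. With [excess_geD]
    it places the slopes of [G] on [[q, r]] between [- S(q)] and [- S(r)]. *)
Lemma excess_leD q r : q <= r ->
  excess Y q <= excess Y r + (r - q) * survival Y q.
Proof.
move=> qr; rewrite -Rintegral_excessD_survival; apply: le_Rintegral => //.
- exact: integrable_excess.
- exact: integrable_excessD_survival.
move=> t _; rewrite indic_gt.
case: (ltP q (Y t)) => h;
  rewrite ?(mulr1, mulr0); case: (leP 0 (Y t - q)) => ?;
  case: (leP 0 (Y t - r)) => ?; lra.
Qed.

Lemma excess_geD q r : q <= r ->
  excess Y r + (r - q) * survival Y r <= excess Y q.
Proof.
move=> qr; rewrite -Rintegral_excessD_survival; apply: le_Rintegral => //.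
- exact: integrable_excessD_survival.
- exact: integrable_excess.
move=> t _; rewrite indic_gt.
case: (ltP r (Y t)) => h;
  rewrite ?(mulr1, mulr0); case: (leP 0 (Y t - q)) => ?;
  case: (leP 0 (Y t - r)) => ?; lra.
Qed.

(** Jensen's inequality for the positive part; below the mean it forces [G(r) > 0]. *)
Lemma mean_subr_le_excess r : \int[P]_t Y t - r <= excess Y r.
Proof.
have ir : P.-integrable setT (EFin \o (cst r : T -> R)).
  exact: finite_measure_integrable_cst.
have -> : \int[P]_t Y t - r = \int[P]_t (Y t - r).
  rewrite RintegralB//; congr (_ - _).
  by rewrite Rintegral_cst_probability.
apply: le_Rintegral => //.
- rewrite (_ : EFin \o _ = ((EFin \o Y) \- (EFin \o cst r))%E)//.
  exact: integrableB.
- exact: integrable_excess.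
by move=> t _; rewrite le_max lexx orbT.
Qed.

Lemma supplier_payoffE r : supplier_payoff Y r = (r * excess Y r)%:E.
Proof.
rewrite /supplier_payoff unlock EFinM /excess /Rintegral fineK//.
exact: (integrable_fin_num _ (integrable_excess r)).
Qed.

(* That is, [E(Y | Y > r)] is nondecreasing in [r]. *)
Lemma mrdD_nondecreasing q r : q <= r -> 0 < survival Y r ->
  excess Y q / survival Y q + q <= excess Y r / survival Y r + r.
Proof.
move=> qr Sr.
have Sqr := survival_nonincreasing Y q r qr.
have Sq := lt_le_trans Sr Sqr.
have : excess Y q / survival Y q <= excess Y r / survival Y q + (r - q).
  rewrite ler_pdivrMr// mulrDl divfK ?gt_eqF//; exact: excess_leD.
have : excess Y r / survival Y q <= excess Y r / survival Y r.
  by rewrite ler_wpM2l ?excess_ge0// lef_pV2.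
lra.
Qed.

(** Since [S(r) <= 1], dividing by it can only increase [G(r)], which is already at least
    [E(Y) - r]. *)
Lemma mean_le_mrdD r : 0 < survival Y r ->
  \int[P]_t Y t <= excess Y r / survival Y r + r.
Proof.
move=> Sr; have := mean_subr_le_excess r.
have : excess Y r <= excess Y r / survival Y r.
  by rewrite ler_peMr ?excess_ge0// invf_ge1// survival_le1.
lra.
Qed.

(** * A maximizer of the payoff is a fixed point of the mean residual demand *)

Section Maximizer.
Variable s : R.
Hypothesis EY_gt0 : 0 < \int[P]_t Y t.
Hypothesis s_opt : optimal_price Y s.

Let s_max t : 0 <= t -> t * excess Y t <= s * excess Y s.
Proof. by case: s_opt => _ /(_ t) h /h; rewrite !supplier_payoffE lee_fin. Qed.

(** Half the mean [m] is a price with payoff at least [(m / 2)^2]. This rules out a maximizer at 0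
    or at a point of zero survival. *)
Lemma optimal_payoff_gt0 : 0 < s * excess Y s.
Proof.
set m := \int[P]_t Y t; have m0 : 0 < m by [].
have := mean_subr_le_excess (m / 2); rewrite -/m => h.
apply: (@lt_le_trans _ _ (m / 2 * excess Y (m / 2))); last by apply: s_max; lra.
by apply: mulr_gt0; lra.
Qed.

Lemma optimal_price_gt0 : 0 < s.
Proof.
case: s_opt; rewrite le_eqVlt => /orP[/eqP s0|//] _.
by have := optimal_payoff_gt0; rewrite -s0 mul0r ltxx.
Qed.

Lemma optimal_survival_gt0 : 0 < survival Y s.
Proof.
rewrite lt_neqAle survival_ge0 andbT; apply/negP => /eqP S0.
by have := optimal_payoff_gt0; rewrite excess0// mulr0 ltxx.
Qed.

Lemma optimal_price_le_mrd : s <= mrd Y s.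
Proof.
have s0 := optimal_price_gt0; have S0 := optimal_survival_gt0.
rewrite mrdE; last exact: ltW.
rewrite leNgt; apply/negP; set m := (_ / _) => ms.
have m0 : 0 <= m by rewrite divr_ge0 ?excess_ge0// ltW.
have Es : excess Y s = m * survival Y s by rewrite divfK// gt_eqF.
(* The slope bound gives [t G(t) >= t (m + s - t) S(s)], and the midpoint maximizes the right-hand
   side. Its value there exceeds [s m S(s)], the payoff at [s], by [(s - m)^2 S(s) / 4]. *)
pose t := (m + s) / 2.
have := @s_max t; have := @excess_geD t s; rewrite Es /t => h1 h2.
have {}h1 : m * survival Y s + (s - t) * survival Y s <= excess Y t.
  by apply: h1; lra.
have {}h2 : t * excess Y t <= s * (m * survival Y s) by apply: h2; lra.
have : 0 < (s - m) ^+ 2 * survival Y s by rewrite mulr_gt0 ?exprn_gt0//; lra.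
have : t * (m * survival Y s + (s - t) * survival Y s) <= t * excess Y t.
  by rewrite ler_wpM2l// /t; lra.
rewrite /t in h1 h2 *; nra.
Qed.

Lemma mrd_le_optimal_price : mrd Y s <= s.
Proof.
have s0 := optimal_price_gt0; have S0 := optimal_survival_gt0.
rewrite mrdE; last exact: ltW.
rewrite leNgt; apply/negP; set m := (_ / _) => ms.
have Es : excess Y s = m * survival Y s by rewrite divfK// gt_eqF.
(* The same midpoint, now to the right of [s]: [excess_leD] yields the same lower bound for the
   payoff at [t]. *)
pose t := (m + s) / 2.
have := @s_max t; have := @excess_leD s t; rewrite Es /t => h1 h2.
have {}h1 : m * survival Y s <= excess Y t + (t - s) * survival Y s.
  by apply: h1; lra.
have {}h2 : t * excess Y t <= s * (m * survival Y s) by apply: h2; lra.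
have : 0 < (s - m) ^+ 2 * survival Y s.
  by rewrite -sqrrN opprB mulr_gt0 ?exprn_gt0//; lra.
have : t * (m * survival Y s - (t - s) * survival Y s) <= t * excess Y t.
  by rewrite ler_wpM2l ?lerBlDr// /t; lra.
rewrite /t in h1 h2 *; nra.
Qed.
End Maximizer.
End Integrable.

(** * Integrability and positivity of the mean *)

Lemma integrable_ge0_mean (Y : {RV P >-> R}) (m : R) :
  {ae P, forall t, 0 <= Y t} -> 'E_P[Y]%E = m%:E ->
  P.-integrable setT (EFin \o Y).
Proof.
move=> Y0; rewrite unlock => Ym.
have mY : measurable_fun setT (EFin \o Y) by exact/measurable_EFinP.
apply/integrableP; split => //.
(* Almost surely [|Y| = Y], so the integral of [|Y|] is the finite number [m]. *)
rewrite (ae_eq_integral (EFin \o Y))//; last 2 first.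
- exact: measurableT_comp.
- by apply: filterS Y0 => t /= Yt _; rewrite ger0_norm.
by rewrite [ltLHS]Ym ltry.
Qed.

(** A zero mean would make [Y] vanish almost everywhere, whereas [F(0) = 0] says that [Y > 0] has
    probability 1. *)
Lemma mean_gt0 (Y : {RV P >-> R}) :
  P.-integrable setT (EFin \o Y) -> {ae P, forall t, 0 <= Y t} ->
  cdf Y 0 = 0%E -> 0 < \int[P]_t Y t.
Proof.
move=> iY Y0 F0.
have S1 : survival Y 0 = 1 by move: F0; rewrite cdf_survival => -[]; lra.
have mY : measurable_fun setT (EFin \o Y) by exact/measurable_EFinP.
have intY : (\int[P]_t `|(EFin \o Y) t| = \int[P]_t (Y t)%:E)%E.
  rewrite (ae_eq_integral (EFin \o Y))//; first exact: measurableT_comp.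
  by apply: filterS Y0 => t /= Yt _; rewrite ger0_norm.
rewrite lt_neqAle fine_ge0 ?andbT; last first.
  by rewrite -intY; apply: integral_ge0 => t _; exact: abse_ge0.
apply/negP => /eqP m0.
have /(ae_eq_integral_abs P measurableT mY) Yae :
    (\int[P]_t `|(EFin \o Y) t| = 0)%E.
  by rewrite intY -[LHS]fineK ?(integrable_fin_num _ iY)// -[fine _]m0.
have : P [set t | 0 < Y t] = 0%E.
  apply: measure_negligible => //.
  apply: negligibleS Yae => t /= Yt h.
  by have := h I; move=> -[] Yt0; rewrite Yt0 ltxx in Yt.
by rewrite -survivalK S1 => /eqP; rewrite eqe oner_eq0.
Qed.

(** * Mean residual demand of the mixture with a constant *)

Section Mix.
Variables (X : {RV P >-> R}) (mu kappa : R).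
Hypothesis iX : P.-integrable setT (EFin \o X).
Hypothesis Xmu : \int[P]_t X t = mu.

Let Xk := mix_with_const kappa mu X.

Lemma mix_with_constE t : Xk t = kappa * X t + (1 - kappa) * mu.
Proof. by []. Qed.

Lemma integrable_mix : P.-integrable setT (EFin \o Xk).
Proof.
rewrite (_ : EFin \o Xk = ((fun t => kappa%:E * (X t)%:E) \+
   (EFin \o cst ((1 - kappa) * mu)%R))%E)//.
apply: integrableD => //; first exact: integrableZl.
exact: finite_measure_integrable_cst.
Qed.

Lemma mean_mix : \int[P]_t Xk t = mu.
Proof.
rewrite RintegralD//; last 2 first.
- rewrite (_ : EFin \o _ = (fun t => kappa%:E * (X t)%:E)%E)//.
  exact: integrableZl.
- exact: finite_measure_integrable_cst.
rewrite RintegralZl// Rintegral_cst_probability Xmu/=; ring.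
Qed.

(** For [kappa > 0] the affine map is strictly increasing, so the threshold events coincide. *)
Lemma survival_mix q : 0 < kappa ->
  survival Xk (kappa * q + (1 - kappa) * mu) = survival X q.
Proof.
move=> k0; rewrite /survival; congr (fine (P _)).
by apply/funext => t; rewrite /mkset mix_with_constE ltrD2r ltr_pM2l.
Qed.

Lemma excess_mix q : 0 < kappa ->
  excess Xk (kappa * q + (1 - kappa) * mu) = kappa * excess X q.
Proof.
move=> k0; rewrite /excess -RintegralZl//; last exact: integrable_excess.
apply: eq_Rintegral => t _; rewrite mix_with_constE.
rewrite maxr_pMr ?ltW// mulr0; congr (Num.max _ _); ring.
Qed.

Lemma mrd_mix_le (r : R) : 0 <= kappa <= 1 -> 0 < mu -> strictly_DGMRD X ->
  0 <= r -> mrd Xk r <= mrd X r.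
Proof.
move=> /andP[k0 k1] mu0 dgmrd r0.
have [S0|] := eqVneq (survival Xk r) 0.
  by rewrite (mrdE Xk)// S0 invr0 mulr0 mrd_ge0.
rewrite neq_lt ltNge survival_ge0/= => Sk.
(* Zero survival would give [mu - r <= G(r) = 0]. *)
have SX : r < mu -> 0 < survival X r.
  move=> rmu; rewrite lt_neqAle survival_ge0 andbT; apply/negP => /eqP S0.
  by have := mean_subr_le_excess _ iX r; rewrite Xmu excess0//; lra.
rewrite le_eqVlt in k0; case/orP: k0 => [/eqP k0|k0].
  (* Deterministic case: positive survival forces [r < mu], and [mu - r] is bounded by
     [mean_le_mrdD]. *)
  have XkE t : Xk t = mu by rewrite mix_with_constE -k0; ring.
  have rmu : r < mu.
    rewrite ltNge; apply/negP => mur; move: Sk; rewrite /survival.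
    rewrite (_ : [set t | _] = set0) ?measure0 ?ltxx//.
    by rewrite -subset0 => t; rewrite /mkset XkE ltNge mur.
  have Sk1 : survival Xk r = 1.
    rewrite /survival (_ : [set t | _] = setT) ?probability_setT//.
    by rewrite -subTset => t _; rewrite /mkset XkE.
  have Gk : excess Xk r = mu - r.
    rewrite /excess (_ : (fun t => _) = cst (mu - r)).
      by rewrite Rintegral_cst_probability.
    by apply/funext => t; rewrite XkE max_r// subr_ge0 ltW.
  rewrite !mrdE// Gk Sk1 divr1.
  have := mean_le_mrdD _ iX r (SX rmu); rewrite Xmu; lra.
(* The preimage of [r] under the affine map. It may be negative when [r < mu], where [mrdE] does not
   apply; the bounds at [q] are therefore stated for the quotient of [excess] by [survival]. *)
pose q := (r - (1 - kappa) * mu) / kappa.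
have kq : kappa * q = r - (1 - kappa) * mu by rewrite mulrC divfK ?gt_eqF.
have rE : r = kappa * q + (1 - kappa) * mu by rewrite kq; ring.
rewrite (mrdE Xk)// {1 2}rE excess_mix// survival_mix// -mulrA.
have Sq : 0 < survival X q by rewrite -survival_mix// -rE.
have mqmu := mean_le_mrdD _ iX q Sq; rewrite Xmu in mqmu.
set m := excess X q / survival X q.
have m0 : 0 <= m by rewrite divr_ge0 ?excess_ge0 ?survival_ge0.
have [rmu|mur] := ltP r mu.
  have qr : q <= r by rewrite -(ler_pM2l k0) kq; nra.
  have := mrdD_nondecreasing _ iX q r qr (SX rmu).
  rewrite mrdE// -/m.
  (* Replacing [mu] by the larger [m + q] in [rE] gives [r <= q + (1 - kappa) * m]; then
     [m + q - r >= kappa * m]. *)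
  have : (1 - kappa) * mu <= (1 - kappa) * (m + q).
    by rewrite ler_wpM2l// subr_ge0.
  lra.
have rgt0 : 0 < r by lra.
have : r <= q by rewrite -(ler_pM2l k0) kq; nra.
(* Equality [q = r] occurs for [r = mu] or [kappa = 1]; strict decrease says nothing there, and
   [kappa <= 1] suffices. *)
rewrite le_eqVlt => /orP[/eqP rq|rq].
  rewrite mrdE// rq -/m; nra.
have q0 := lt_trans rgt0 rq.
have := dgmrd r q rgt0 rq; rewrite lt_support_end ?(ltW q0)// => /(_ Sq).
rewrite (mrdE X q) ?(ltW q0)// -/m ltr_pdivrMr// => mq.
have -> : mrd X r = mrd X r / r * r by rewrite divfK ?gt_eqF.
have h0 : 0 <= mrd X r / r by rewrite divr_ge0 ?mrd_ge0.
have h1 : kappa * m <= kappa * (mrd X r / r * q) by rewrite ler_wpM2l// ltW.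
apply: (le_trans h1).
(* What remains is [kappa * q <= r], that is, [(1 - kappa) * mu >= 0]. *)
rewrite mulrCA ler_wpM2l// kq lerBlDr lerDl mulr_ge0//; lra.
Qed.
End Mix.
End Excess.

(** * Stochastic comparison and the resulting order of the prices *)

Theorem theorem4p7 (R : realType) (d : measure_display)
    (T : measurableType d) (P : probability T R) (X : {RV P >-> R})
    (mu sigma kappa : R)
    (X_ge0 : {ae P, forall t, 0 <= X t})
    (X_cont : continuous_demand X)
    (X_dgmrd : strictly_DGMRD X)
    (X_mean : 'E_P[X]%E = mu%:E)
    (X_var : 'V_P[X]%E = (sigma ^+ 2)%:E)
    (kappa01 : 0 <= kappa <= 1) :
  mrd_le (mix_with_const kappa mu X) X /\
  forall r_kappa r_star : R,
    optimal_price (mix_with_const kappa mu X) r_kappa ->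
    optimal_price X r_star ->
    r_kappa <= r_star.
Proof.
have iX := integrable_ge0_mean X mu X_ge0 X_mean.
have Xmu : \int[P]_t X t = mu.
  by move: X_mean; rewrite unlock /Rintegral => ->.
have mu0 : 0 < mu by rewrite -Xmu; apply: mean_gt0 => //; case: X_cont.
have mle : mrd_le (mix_with_const kappa mu X) X.
  by move=> r; apply: mrd_mix_le.
split=> // rk rs rk_opt rs_opt.
have iXk := integrable_mix X mu kappa iX.
have Xkmu := mean_mix X mu kappa iX Xmu.
have X0 : 0 < \int[P]_t X t by rewrite Xmu.
have Xk0 : 0 < \int[P]_t mix_with_const kappa mu X t by rewrite Xkmu.
have rk0 := optimal_price_gt0 _ iXk _ Xk0 rk_opt.
have rs0 := optimal_price_gt0 _ iX _ X0 rs_opt.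
have rk_le :=
  le_trans (optimal_price_le_mrd _ iXk _ Xk0 rk_opt) (mle _ (ltW rk0)).
have le_rs := mrd_le_optimal_price _ iX _ X0 rs_opt.
rewrite leNgt; apply/negP => rs_rk.
(* Otherwise [mrd X rk] takes its default value 0, against [0 < rk <= mrd X rk]. *)
have rkH : (rk%:E < support_end X)%E.
  rewrite ltNge; apply/negP => h; move: rk_le.
  by rewrite /mrd ltNge h/= leNgt rk0.
have := X_dgmrd _ _ rs0 rs_rk rkH; apply/negP; rewrite -leNgt.
(* The value 1 separates the two ratios [mrd X r / r]: at most 1 at [rs], at least 1 at [rk]. *)
rewrite (@le_trans _ _ 1)//; first by rewrite ler_pdivrMr// mul1r.
by rewrite ler_pdivlMr// mul1r.
Qed.
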